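(* For every deterministic interactive Turing machine $M$ there is a lineage $A_1, A_2, \dots$ of deterministic autopoietic automata (reading a single input stream, each $A_{i+1}$ being the new offspring of $A_i$ and continuing to read the input stream from the position reached by $A_i$) that simulates $M$, i.e., on every input stream the lineage produces the same output stream as $M$.
   Context: A (deterministic) autopoietic automaton $A$ is a finite automaton with state set $Q$, a start state $q_0 \in Q\setminus R$, a subset $R\subseteq Q$ of reproducing-mode states (states in $Q\setminus R$ are transducer-mode states), a special state $q_1\in R$, and a transition partial function $\delta$ (a partial function of (observed symbol, current state), giving a new state, a symbol to write, and a direction). Symbols come from a potentially infinite alphabet $\sigma_1,\sigma_2,\dots$, with $\sigma_i$ encoded in unary by $i$. The automaton has a finite read-only input tape which always contains the code of $A$: a sequence, in arbitrary order, of 5-tuples, one per transition of $\delta$. In reproducing mode (states in $R$) the automaton moves a head on this read-only input tape and writes symbols onto a one-way output tape. In transducer mode (states in $Q\setminus R$) it does not touch the tapes, but reads one symbol at a time from an input buffer connected to an infinite input stream and writes one symbol at a time into an output buffer, producing an output stream. When reproducing mode ends by entering $q_1$, $A$ splits into the old $A$ (same input tape, empty output tape) and the offspring $A'$ whose input tape is the previous output tape and whose output tape is empty; both start in $q_0$ with heads at the left end. If the offspring's input tape is not a proper encoding of a transition function, it stops. The offspring relation defines a tree; a lineage is a path $A_1, A_2,\dots$ in this tree. An interactive Turing machine is a Turing machine that reads one symbol at a time from an input buffer connected to an input stream and writes one symbol at a time to an output buffer, creating an output stream. *)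

(* Defs.v *)
From mathcomp Require Import all_boot.

Set Implicit Arguments.
Unset Strict Implicit.
Unset Printing Implicit Defensive.

(*  Symbols.  The symbol sigma_i (i >= 1) is represented by the natural i.   *)
(*  The value 0 is used for "no symbol": as an observed symbol it is the     *)
(*  blank seen past the right end of the finite input tape; as a written     *)
(*  symbol it means "write nothing" (the empty symbol lambda).               *)
(*  Code alphabet of the tapes:  sigma_1 = unary digit, sigma_2 = separator  *)
(*  between the components of a 5-tuple, sigma_3 = end of a 5-tuple.         *)

(* A transition (5-tuple): (observed symbol a, state q, new state q',
   written symbol b, direction d) with d = 0 (left), 1 (stay), 2 (right).
   States are naturals; q0 = 0, q1 = 1, and the reproducing-mode states R
   are the odd-numbered ones (so q0 \notin R and q1 \in R). *)
Definition trans := (nat * nat * nat * nat * nat)%type.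

Definition tr_sym (t : trans) : nat := t.1.1.1.1.
Definition tr_st (t : trans) : nat := t.1.1.1.2.
Definition tr_new (t : trans) : nat := t.1.1.2.
Definition tr_wr (t : trans) : nat := t.1.2.
Definition tr_dir (t : trans) : nat := t.2.

Definition aa_q0 : nat := 0.
Definition aa_q1 : nat := 1.
Definition reproducing (q : nat) : bool := odd q.

Definition encode_tr (t : trans) : seq nat :=
  nseq (tr_sym t) 1 ++ 2 :: nseq (tr_st t) 1 ++ 2 :: nseq (tr_new t) 1 ++ 2 ::
  nseq (tr_wr t) 1 ++ 2 :: nseq (tr_dir t) 1 ++ [:: 3].

Definition encode (c : seq trans) : seq nat := flatten (map encode_tr c).

Fixpoint read_unary (s : seq nat) : nat * seq nat :=
  match s with
  | 1 :: s' => let: (n, r) := read_unary s' in (n.+1, r)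
  | _ => (0, s)
  end.

Definition field (sep : nat) (s : seq nat) : option (nat * seq nat) :=
  let: (n, r) := read_unary s in
  if r is x :: r' then (if x == sep then Some (n, r') else None) else None.

Fixpoint decode_aux (fuel : nat) (s : seq nat) : option (seq trans) :=
  if s is [::] then Some [::] else
  if fuel is fuel'.+1 then
    obind (fun p1 : nat * seq nat => let: (a, s1) := p1 in
    obind (fun p2 : nat * seq nat => let: (q, s2) := p2 in
    obind (fun p3 : nat * seq nat => let: (q', s3) := p3 in
    obind (fun p4 : nat * seq nat => let: (b, s4) := p4 in
    obind (fun p5 : nat * seq nat => let: (d, s5) := p5 in
      omap (cons (a, q, q', b, d)) (decode_aux fuel' s5))
    (field 3 s4)) (field 2 s3)) (field 2 s2)) (field 2 s1)) (field 2 s)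
  else None.

Definition decode (s : seq nat) : option (seq trans) := decode_aux (size s) s.

Definition wf_code (c : seq trans) : bool :=
  uniq [seq (tr_sym t, tr_st t) | t <- c] && all (fun t => tr_dir t <= 2) c.

Definition proper_code (tape : seq nat) : option (seq trans) :=
  if decode tape is Some c then (if wf_code c then Some c else None) else None.

Definition aa_delta (c : seq trans) (a q : nat) : option (nat * nat * nat) :=
  ohead [seq (tr_new t, tr_wr t, tr_dir t)
        | t <- c & (tr_sym t == a) && (tr_st t == q)].

(*  Configuration of a lineage: the currently living member A_i of the       *)
(*  lineage (its read-only input tape and decoded code), its state, the      *)
(*  head position on the input tape, its output tape, the position reached   *)
(*  in the input stream, and the output stream produced so far.              *)
Record lconf := LConf {
  l_tape : seq nat;
  l_code : seq trans;
  l_state : nat;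
  l_head : nat;
  l_otape : seq nat;
  l_pos : nat;
  l_out : seq nat }.

Definition lstep (inp : nat -> nat) (C : lconf) : option lconf :=
  let: LConf tape code q hd otape pos out := C in
  let a := if reproducing q then nth 0 tape hd else inp pos in
  match aa_delta code a q with
  | None => None
  | Some (q', b, d) =>
    let: (hd', otape', pos', out') :=
      if reproducing q then
        (if d == 0 then hd.-1 else if d == 1 then hd else minn hd.+1 (size tape),
         (if b == 0 then otape else rcons otape b), pos, out)
      else
        (hd, otape, (if d == 2 then pos.+1 else pos),
         (if b == 0 then out else rcons out b)) in
    if q' == aa_q1 then
      (* split: the lineage continues with the new offspring, whose input
         tape is the output tape; it starts in q0 with empty output tape and
         continues reading the input stream where its parent stopped *)
      match proper_code otape' with
      | Some c' => Some (LConf otape' c' aa_q0 0 [::] pos' out')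
      | None => None
      end
    else Some (LConf tape code q' hd' otape' pos' out')
  end.

Definition lrun (inp : nat -> nat) (C : lconf) (t : nat) : lconf :=
  iter t (fun C => if lstep inp C is Some C' then C' else C) C.

Definition lineage_start (c : seq trans) : lconf :=
  LConf (encode c) c aa_q0 0 [::] 0 [::].

(* output stream of the lineage started with A_1 = code c, as the
   increasing family of its finite prefixes *)
Definition lineage_out (c : seq trans) (inp : nat -> nat) (t : nat) : seq nat :=
  l_out (lrun inp (lineage_start c) t).

(*  Deterministic interactive Turing machines (one two-way infinite work     *)
(*  tape), with input alphabet 'I_kin (symbol i read as sigma_(i+1)) and     *)
(*  output alphabet 'I_kout (symbol o written as sigma_(o+1)).               *)
Inductive move := MoveL | MoveS | MoveR.

Inductive iaction (Q G : Type) (kin kout : nat) :=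
  | IHalt
  | IWork of Q & G & move & option 'I_kout
  | IRead of ('I_kin -> Q * G * move * option 'I_kout).
Arguments IHalt {Q G kin kout}.

(* work tape as a zipper: cells left of the head (nearest first), scanned
   cell, cells right of the head *)
Definition wtape (G : Type) := (seq G * G * seq G)%type.

Definition tmove (G : Type) (blank : G) (m : move) (T : wtape G) : wtape G :=
  let: (l, x, r) := T in
  match m with
  | MoveS => T
  | MoveL => if l is y :: l' then (l', y, x :: r) else ([::], blank, x :: r)
  | MoveR => if r is y :: r' then (x :: l, y, r') else (x :: l, blank, [::])
  end.

Record iconf (Q G : Type) (kout : nat) := IConf {
  i_state : Q; i_tape : wtape G; i_pos : nat; i_out : seq 'I_kout }.

Definition istep (Q G : Type) (kin kout : nat) (blank : G)
    (delta : Q -> G -> iaction Q G kin kout) (inp : nat -> 'I_kin)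
    (C : iconf Q G kout) : option (iconf Q G kout) :=
  let: IConf q T pos out := C in
  let: (l, x, r) := T in
  let apply '(q', y, m, o) pos' :=
      Some (IConf q' (tmove blank m (l, y, r)) pos'
                  (if o is Some z then rcons out z else out)) in
  match delta q x with
  | IHalt => None
  | IWork q' y m o => apply (q', y, m, o) pos
  | IRead f => apply (f (inp pos)) pos.+1
  end.

Definition irun (Q G : Type) (kin kout : nat) (blank : G)
    (delta : Q -> G -> iaction Q G kin kout) (inp : nat -> 'I_kin)
    (C : iconf Q G kout) (t : nat) : iconf Q G kout :=
  iter t (fun C => if istep blank delta inp C is Some C' then C' else C) C.

Definition itm_out (Q G : Type) (kin kout : nat) (blank : G) (q0 : Q)
    (delta : Q -> G -> iaction Q G kin kout) (inp : nat -> 'I_kin) (t : nat)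
    : seq nat :=
  [seq (nat_of_ord o).+1
  | o <- i_out (irun blank delta inp (IConf q0 ([::], blank, [::]) 0 [::]) t)].

(* Two output streams, each given by its increasing finite prefixes,
   coincide: the same symbol appears at each position (or no symbol). *)
Definition emits (f : nat -> seq nat) (n y : nat) : Prop :=
  exists t, onth (f t) n = Some y.

Definition same_stream (f g : nat -> seq nat) : Prop :=
  forall n y, emits f n y <-> emits g n y.

(* Main.v *)
(* One lineage generation performs one step of the machine. A member's code is
   a block of inert data tuples spelling out the work tape, followed by a
   fixed program; the data tuples have source state 1, which is never active
   because entering it splits the automaton. The program makes one left-to-
   right pass over its own code, with no left move: each data tuple is
   copied with its index (which keeps keys distinct) increased by 2, but
   with the content read from the previous tuple, so that every left
   neighbour is still to be written when the scanned cell is met and a left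
   move of the machine needs no backtracking. At the scanned cell the
   automaton passes through a transducer state in order to read and write
   the streams. The new indices leave 0 and 1 free at the right end, so the
   offspring gains a blank cell on either side and the simulated head never
   leaves the stored tape. The rest, i.e. the program, is copied verbatim. *)
Require Import Defs.
From HB Require Import structures.
From mathcomp Require Import all_boot zify.

Set Implicit Arguments.
Unset Strict Implicit.
Unset Printing Implicit Defensive.

(** * Codes and lineages *)

Lemma encode_cat c1 c2 : encode (c1 ++ c2) = encode c1 ++ encode c2.
Proof. by rewrite /encode map_cat flatten_cat. Qed.

Lemma field_nseq sep n r : sep != 1 -> field sep (nseq n 1 ++ sep :: r) = Some (n, r).
Proof.
move=> sep1; rewrite /field.
suff -> : read_unary (nseq n 1 ++ sep :: r) = (n, sep :: r) by rewrite eqxx.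
by elim: n => [|n /= -> //]; case: sep sep1 => [|[|sep]].
Qed.

Lemma decode_encode c : decode (encode c) = Some c.
Proof.
(* Every tuple has a nonempty encoding, so the tape length is enough fuel; the induction then allows
   any fuel of at least [size c]. *)
have size_encode : size c <= size (encode c).
  elim: c => //= -[[[[a q] q'] b] d] c IHc.
  by rewrite /encode /= -/(encode c) !size_cat /= !size_cat /=; lia.
rewrite /decode; move: (size (encode c)) size_encode => fuel.
elim: c fuel => [|t c IHc] [|fuel] //= le_c.
have -> : encode (t :: c) = encode_tr t ++ encode c by [].
case: t => [[[[a q] q'] b] d].
rewrite /encode_tr /tr_sym /tr_st /tr_new /tr_wr /tr_dir /=.
do !rewrite -?catA /=.
case E: (nseq a 1 ++ _) => [|x s]; first by case: a E.
by rewrite -{}E; do 5!rewrite field_nseq //=; rewrite IHc.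
Qed.

Lemma encode_tr_neq0 t : 0 \notin encode_tr t.
Proof.
by rewrite /encode_tr; do !rewrite !(mem_cat, inE) /= ?mem_nseq ?andbF.
Qed.

Lemma encode_sym c : all [pred a | 0 < a < 4] (encode c).
Proof.
elim: c => //= t c IHc.
rewrite [encode _]/(encode_tr t ++ encode c) all_cat IHc andbT.
by rewrite /encode_tr; do !rewrite !all_cat ?all_nseq /= ?orbT.
Qed.

Definition key (t : trans) := (tr_sym t, tr_st t).

Lemma aa_delta_mem c t : uniq (map key c) -> t \in c ->
  aa_delta c (tr_sym t) (tr_st t) = Some (tr_new t, tr_wr t, tr_dir t).
Proof.
elim: c => //= t0 c IHc /andP[nt0 uc]; rewrite inE => /predU1P[->|tc].
  by rewrite /aa_delta /= !eqxx.
rewrite /aa_delta /=; case: ifP => [/andP[/eqP e1 /eqP e2]|_]; last exact: IHc.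
by move: nt0; rewrite /key e1 e2 -/(key t) map_f.
Qed.

Lemma aa_delta_none c a q : (a, q) \notin map key c -> aa_delta c a q = None.
Proof.
rewrite /aa_delta => H; case E: (filter _ c) => [|t' s] //=.
have : t' \in t' :: s by rewrite mem_head.
rewrite -E mem_filter => /andP[/andP[/eqP et1 /eqP et2] t'c].
by case/negP: H; apply/mapP; exists t' => //; rewrite /key et1 et2.
Qed.

(** * Reachability along a lineage and growth of its output *)

Section Runs.

Variable inp : nat -> nat.

Lemma lrunD C t1 t2 : lrun inp C (t1 + t2) = lrun inp (lrun inp C t1) t2.
Proof. by rewrite /lrun addnC iterD. Qed.

Definition reach C C' := exists t, lrun inp C t = C'.

Lemma reach_refl C : reach C C.
Proof. by exists 0. Qed.

Lemma reach_trans C2 C1 C3 : reach C1 C2 -> reach C2 C3 -> reach C1 C3.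
Proof. by move=> [t1 <-] [t2 <-]; exists (t1 + t2); rewrite lrunD. Qed.

Lemma reach_step C C' : lstep inp C = Some C' -> reach C C'.
Proof. by move=> E; exists 1; rewrite /lrun /= E. Qed.

Lemma lrun_stuck C t : lstep inp C = None -> lrun inp C t = C.
Proof. by move=> E; elim: t => //= t; rewrite /lrun /= => ->; rewrite E. Qed.

Lemma lrun_prefix C t1 t2 : t1 <= t2 ->
  prefix (l_out (lrun inp C t1)) (l_out (lrun inp C t2)).
Proof.
move/subnK <-; elim: (_ - _) => [|n IHn]; first exact: prefix_refl.
rewrite addSn; apply: (prefix_trans IHn).
rewrite /lrun iterS -/(lrun inp C _).
case: (lrun inp C _) => tape code q hd otape pos out /=.
case: aa_delta => [[[q' b] d]|]; last exact: prefix_refl.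
case: (reproducing q) => /=.
  case: (q' == _); last exact: prefix_refl.
  case: (proper_code _) => [c'|]; exact: prefix_refl.
case: (q' == _); last by case: (b == 0); rewrite ?prefix_refl ?prefix_rcons.
case: (proper_code _) => [c'|]; last exact: prefix_refl.
by case: (b == 0); rewrite ?prefix_refl ?prefix_rcons.
Qed.

End Runs.

Lemma prefix_onth (T : eqType) (s1 s2 : seq T) n y :
  prefix s1 s2 -> onth s1 n = Some y -> onth s2 n = Some y.
Proof.
case/prefixP => s ->; rewrite onth_cat => E.
by rewrite -onthTE E.
Qed.

(** * The program *)

Section Control.

Variables Q G : finType.

Definition cell := (G * option Q)%type.
(* What is carried past the current tuple: the delayed content, and the machine
   state with which the next cell read is to be marked as scanned, if any. *)
Definition carry := (cell * option Q)%type.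

(** [Index] and [Tag] copy the first two fields of a data tuple, [Count] measures its unary content,
    [Put] and [Close] write the delayed content and finish the tuple. The flag of [Index] says that
    the two extra digits are still to be written. [PutEnd] takes over at the end marker. *)
Inductive ctl :=
  | Start
  | Index of bool & carry
  | Tag of carry
  | Count of carry & 'I_#|{: option cell}|.+1
  | Act of cell & Q & G
  | Put of cell & carry
  | Close of carry
  | PutEnd of carry
  | Copy
  | Done.

(** Embeds [ctl] in a sum of finite types, so that control states can be enumerated and numbered. *)
Definition ctl_sum (c : ctl) :
    bool * carry + carry + carry * 'I_#|{: option cell}|.+1 + cell * Q * G +
    cell * carry + carry + carry + option bool :=
  match c with
  | Start => inr None
  | Index b e => inl (inl (inl (inl (inl (inl (inl (b, e)))))))
  | Tag e => inl (inl (inl (inl (inl (inl (inr e))))))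
  | Count e n => inl (inl (inl (inl (inl (inr (e, n))))))
  | Act h q g => inl (inl (inl (inl (inr (h, q, g)))))
  | Put h e => inl (inl (inl (inr (h, e))))
  | Close e => inl (inl (inr e))
  | PutEnd e => inl (inr e)
  | Copy => inr (Some true)
  | Done => inr (Some false)
  end.

Definition sum_ctl x : ctl :=
  match x with
  | inr None => Start
  | inl (inl (inl (inl (inl (inl (inl (b, e))))))) => Index b e
  | inl (inl (inl (inl (inl (inl (inr e)))))) => Tag e
  | inl (inl (inl (inl (inl (inr (e, n)))))) => Count e n
  | inl (inl (inl (inl (inr (h, q, g))))) => Act h q g
  | inl (inl (inl (inr (h, e)))) => Put h e
  | inl (inl (inr e)) => Close e
  | inl (inr e) => PutEnd e
  | inr (Some true) => Copy
  | inr (Some false) => Done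
  end.

Lemma ctl_sumK : cancel ctl_sum sum_ctl.
Proof. by case. Qed.

HB.instance Definition _ := Finite.copy ctl (can_type ctl_sumK).

End Control.
Arguments Start {Q G}.
Arguments Copy {Q G}.
Arguments Done {Q G}.

Section Simulation.

Variables (kin kout : nat) (Q G : finType) (blank : G).
Variable delta : Q -> G -> iaction Q G kin kout.

Local Notation cell := (cell Q G).
Local Notation carry := (carry Q G).
Local Notation ctl := (ctl Q G).

Definition code (v : option cell) : nat := index v (enum {: option cell}).

Definition item k (v : option cell) : trans := (k, 1, code v, 0, 0).

(** [PutEnd] completes the current tuple, inserts one of index 1 for the fresh right blank, and
    begins the end marker anew with index 0; the closing symbols of the marker come from the input
    tape. *)
Definition word (c : ctl) : seq nat :=
  match c with
  | Index true _ => [:: 1; 1]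
  | Put h _ => nseq (code (Some h)) 1
  | PutEnd (h, f) =>
      nseq (code (Some h)) 1 ++ [:: 2; 2; 3] ++
      encode_tr (item 1 (Some (blank, f))) ++
      [:: 2; 1; 2] ++ nseq (code None) 1
  | _ => [::]
  end.

(** [h] is the left neighbour, about to be written into the tuple of the scanned cell. A left move
    marks it at once; a right move leaves the mark pending in the carry. *)
Definition rewritten (h : cell) (q : Q) (y : G) (m : move) : cell * carry :=
  match m with
  | MoveL => ((h.1, Some q), ((y, None), None))
  | MoveS => (h, ((y, Some q), None))
  | MoveR => (h, ((y, None), Some q))
  end.

Definition osym (o : option 'I_kout) : nat := if o is Some z then z.+1 else 0.

Definition perform h (r : Q * G * move * option 'I_kout) (d : nat) :=
  let: (q, y, m, o) := r in
  let: (h', e) := rewritten h q y m in Some (Put h' e, osym o, d).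

Definition dispatch (e : carry) (v : option cell) : ctl :=
  match v with
  | None => PutEnd e
  | Some (g, None) => Put e.1 ((g, e.2), None)
  | Some (g, Some q) => Act e.1 q g
  end.

(** The blank that [Start] puts in the carry becomes the new leftmost cell. Direction 1 consumes
    nothing: the separator ending a count is seen again by [Put] or [PutEnd], and only [IRead]
    advances the input stream. *)
Definition act (c : ctl) (a : nat) : option (ctl * nat * nat) :=
  match c, a with
  | Start, _ => Some (Index true ((blank, None), None), 0, 1)
  | Index _ e, 1 => Some (Index false e, 1, 2)
  | Index _ e, 2 => Some (Tag e, 2, 2)
  | Tag e, 1 => Some (Tag e, 1, 2)
  | Tag e, 2 => Some (Count e ord0, 2, 2)
  | Count e n, 1 => Some (Count e (inord n.+1), 0, 2)
  | Count e n, 2 => Some (dispatch e (nth None (enum {: option cell}) n), 0, 1)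
  | Act h q g, _ =>
      match delta q g with
      | IHalt => None
      | IWork q' y m o => perform h (q', y, m, o) 1
      | IRead f => if insub a.-1 is Some s then perform h (f s) 2 else None
      end
  | Put _ e, 2 => Some (Close e, 2, 2)
  | Close e, 2 => Some (Close e, 2, 2)
  | Close e, 3 => Some (Index true e, 3, 2)
  | PutEnd _, 2 => Some (Copy, 2, 2)
  | Copy, 0 => Some (Done, 0, 1)
  | Copy, _ => Some (Copy, a, 2)
  | _, _ => None
  end.

Definition repr (c : ctl) : bool :=
  match c with Start | Act _ _ _ => false | _ => true end.

(* A state (c, i) has already written the first i symbols of [word c]. *)
Definition state := (ctl * 'I_(\max_c size (word c)).+1)%type.

Definition at0 (c : ctl) : state := (c, ord0).

(** 0 and 1 are the prescribed start and splitting states; for the others the parity encodes the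
    mode. *)
Definition num (s : state) : nat :=
  if s == at0 Start then 0 else if s == at0 Done then 1
  else (enum_rank s).+1.*2 + repr s.1.

Definition step (s : state) (a : nat) : option (state * nat * nat) :=
  let: (c, i) := s in
  if i < size (word c) then Some ((c, inord i.+1), nth 0 (word c) i, 1)
  else omap (fun r : ctl * nat * nat => (at0 r.1.1, r.1.2, r.2)) (act c a).

Definition tuple_of (x : nat * state) : trans :=
  let: (s', b, d) := odflt (x.2, 0, 0) (step x.2 x.1) in
  (x.1, num x.2, num s', b, d).

(** The range [4 + kin] covers both the tape symbols 0 to 3 and the input symbols 1 to [kin]. *)
Definition program : seq trans :=
  [seq tuple_of x | x <- [seq (a, s) | a <- iota 0 (4 + kin), s <- enum {: state}]
                  & step x.2 x.1].

(* The value [None] marks the end of the work tape; it always has index 0, and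
   the cells are numbered downwards from left to right. *)
Fixpoint items n (L : seq cell) : seq trans :=
  if L is v :: L' then item (n + size L').+1 (Some v) :: items n L' else [::].

Definition codes (L : seq cell) : seq trans :=
  items 0 L ++ item 0 None :: program.

(** * Well-formedness and transition function of the code *)

Local Arguments num : simpl never.
Local Arguments reproducing : simpl never.

Lemma reproducing_num s : reproducing (num s) = repr s.1.
Proof.
rewrite /reproducing /num; case: eqP => [->|_] //; case: eqP => [->|_] //.
by rewrite oddD odd_double; case: repr.
Qed.

Lemma num_inj : injective num.
Proof.
move=> s1 s2; rewrite /num -!muln2.
case: (s1 =P at0 Start) => [e1|_]; case: (s2 =P at0 Start) => [e2|_];
  case: (s1 =P at0 Done) => [e3|_]; case: (s2 =P at0 Done) => [e4|_];
  try congruence; try lia.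
move=> E; apply/enum_rank_inj/val_inj; move: E; do 2!case: repr; rewrite /=.
all: lia.
Qed.

Lemma num_eq1 s : (num s == 1) = (s == at0 Done).
Proof. exact: (inj_eq num_inj s (at0 Done)). Qed.

Lemma key_tuple_of x : key (tuple_of x) = (x.1, num x.2).
Proof. by rewrite /tuple_of; case: (odflt _ _) => [[s b] d]. Qed.

Lemma uniq_program : uniq (map key program).
Proof.
rewrite -map_comp (eq_map key_tuple_of) map_inj_uniq; last first.
  by move=> [a s] [b t] [-> /num_inj ->].
apply/filter_uniq/allpairs_uniq; rewrite ?iota_uniq ?enum_uniq //.
by move=> [a s] [b t].
Qed.

Lemma dir_step s a r : step s a = Some r -> r.2 <= 2.
Proof.
case: s => c i; rewrite /step; case: ifP => _; first by case=> <-.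
have perf h p d : d <= 2 -> forall x, perform h p d = Some x -> x.2 <= 2.
  by case: p => [[[q y] [||]] o] ? ? [<-].
case E : act => [x|] //= [<-] /=.
case: c {i} E => //=.
- by case=> <-.
- by move=> b e; case: a => [|[|[|a]]] // [<-].
- by move=> e; case: a => [|[|[|a]]] // [<-].
- by move=> e n; case: a => [|[|[|a]]] // [<-].
- move=> h q g; case: (delta q g) => // [q' y m o|f]; first by case: m => -[<-].
  by case: insub => // s; apply: perf.
- by move=> h e; case: a => [|[|[|a]]] // [<-].
- by move=> e; case: a => [|[|[|[|a]]]] // [<-].
- by case=> h f; case: a => [|[|[|a]]] // [<-].
by case: a => [|a] [<-].
Qed.

Lemma dir_program : all (fun t => tr_dir t <= 2) program.
Proof.
apply/allP => t /mapP[x]; rewrite mem_filter => /andP[+ _] ->.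
rewrite /tuple_of; case E: (step x.2 x.1) => [r|] // _.
by move: (dir_step E); case: r {E} => [[]].
Qed.

(** [Done] has no outgoing transition, which leaves source state 1 to the data tuples. *)
Lemma key_program a q : (a, q) \in map key program -> q != 1.
Proof.
case/mapP => t /mapP[x + ->]; rewrite mem_filter key_tuple_of => + [_ ->].
by rewrite num_eq1; apply: contraTneq; case: x => b s /= ->.
Qed.

Lemma key_items n L a q : (a, q) \in map key (items n L) ->
  q = 1 /\ n < a <= n + size L.
Proof.
elim: L => //= v L IHL; rewrite inE => /orP[/eqP[-> ->]|/IHL[-> H]].
  by split; rewrite ?/tr_st ?/tr_sym /=; lia.
by split; lia.
Qed.

Lemma wf_codes L : wf_code (codes L).
Proof.
rewrite /wf_code -/key; apply/andP; split; last first.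
  rewrite all_cat /= dir_program andbT.
  by elim: L => //= v L ->.
rewrite map_cat cat_uniq /= uniq_program andbT negb_or.
apply/and3P; split.
- elim: L => //= v L ->; rewrite andbT; apply/negP => /key_items[_]; rewrite /tr_sym /=; lia.
- rewrite /=; apply/andP; split; first by apply/negP => /key_items[_].
  by apply/hasPn => -[a q] /key_program; apply: contra => /key_items[->].
by apply/negP => /key_program.
Qed.

Lemma proper_codes L : proper_code (encode (codes L)) = Some (codes L).
Proof. by rewrite /proper_code decode_encode wf_codes. Qed.

(** Data tuples are attached to the number of [Done], so in any other state the automaton obeys
    [step], whatever [L] is. *)
Lemma aa_delta_codes L s a : a < 4 + kin -> s != at0 Done ->
  aa_delta (codes L) a (num s) =
    omap (fun r : state * nat * nat => (num r.1.1, r.1.2, r.2)) (step s a).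
Proof.
move=> lt_a s1; case E: (step s a) => [[[s' b] d]|] /=.
  have [wf _] := andP (wf_codes L).
  have Et : tuple_of (a, s) = (a, num s, num s', b, d) by rewrite /tuple_of /= E.
  apply: (aa_delta_mem (t := (a, num s, num s', b, d)) wf).
  rewrite mem_cat inE; apply/or3P/Or33; rewrite -Et; apply/map_f.
  rewrite mem_filter; apply/andP; split; first by rewrite /= E.
  by apply/allpairsPdep; exists a, s; rewrite mem_iota mem_enum; split.
apply: aa_delta_none; rewrite map_cat mem_cat inE /= /key /=.
apply/negP => /or3P[/key_items[/eqP]||].
- by rewrite num_eq1 (negPf s1).
- by rewrite xpair_eqE num_eq1 (negPf s1) andbF.
case/mapP => t /mapP[x + ->]; rewrite mem_filter => /andP[H _].
by rewrite -/(key _) key_tuple_of => -[e1 /num_inj e2]; move: H; rewrite -e1 -e2 E.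
Qed.

(** * One generation *)

Lemma inord0 n : inord 0 = ord0 :> 'I_n.+1.
Proof. by apply/val_inj; rewrite /= inordK. Qed.

Lemma num_start : num (at0 Start) = 0.
Proof. by rewrite /num eqxx. Qed.

Lemma code_lt v : code v < #|{: option cell}|.
Proof. by rewrite cardE index_mem mem_enum. Qed.

Lemma nth_code v : nth None (enum {: option cell}) (code v) = v.
Proof. by rewrite nth_index // mem_enum. Qed.

Lemma word_neq0 c : 0 \notin word c.
Proof.
case: c => // [[] e|h e|[h f]] //; first by rewrite mem_nseq andbF.
rewrite /word; move: (encode_tr _) (encode_tr_neq0 (item 1 (Some (blank, f)))) => s s0.
by rewrite !mem_cat !mem_nseq (negPf s0) !andbF.
Qed.

Lemma items_cat n L1 L2 :
  items n (L1 ++ L2) = items (n + size L2) L1 ++ items n L2.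
Proof. by elim: L1 => //= v L1 ->; rewrite size_cat addnCA addnC. Qed.

Variable inp : nat -> 'I_kin.

Let ninp i := (inp i).+1.

Definition wr b := if b == 0 then [::] else [:: b].

Lemma rcons_wr (s : seq nat) b : (if b == 0 then s else rcons s b) = s ++ wr b.
Proof. by rewrite /wr; case: eqP; rewrite ?cats0 ?cats1. Qed.

Definition mconf := (ctl * seq nat * seq nat * nat * seq nat)%type.

Definition conf L (pre : seq nat) (x : mconf) :=
  let: (c, rest, ot, pos, out) := x in
  LConf (pre ++ rest) (codes L) (num (at0 c)) (size pre) ot pos out.

(** Without left moves the part already read is irrelevant; abstracting over it lets passes over
    consecutive pieces compose. *)
Definition leads L (x y : mconf) :=
  forall pre, exists pre', reach ninp (conf L pre x) (conf L pre' y).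

Lemma leads_refl L x : leads L x x.
Proof. by move=> pre; exists pre; apply: reach_refl. Qed.

Lemma leads_trans L y x z : leads L x y -> leads L y z -> leads L x z.
Proof.
move=> xy yz pre; have [pre1 r1] := xy pre; have [pre2 r2] := yz pre1.
by exists pre2; apply: reach_trans r2.
Qed.

Lemma leads_reach L pre x y C : leads L x y ->
  (forall pre', reach ninp (conf L pre' y) C) -> reach ninp (conf L pre x) C.
Proof. by move=> /(_ pre)[pre' xy] /(_ pre'); apply: reach_trans. Qed.

Lemma lstep_repr L s pre rest ot pos out s' b d :
  repr s.1 -> head 0 rest < 4 -> step s (head 0 rest) = Some (s', b, d) ->
  s' != at0 Done ->
  lstep ninp (LConf (pre ++ rest) (codes L) (num s) (size pre) ot pos out) =
  Some (LConf (pre ++ rest) (codes L) (num s')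
    (if d == 0 then (size pre).-1 else if d == 1 then size pre
     else minn (size pre).+1 (size (pre ++ rest))) (ot ++ wr b) pos out).
Proof.
move=> rs lt4 E s'1; rewrite /= reproducing_num rs.
rewrite nth_cat ltnn subnn nth0 aa_delta_codes ?E /=; last 2 first.
- by apply: leq_trans lt4 _; rewrite leq_addr.
- by apply: contra_eq_neq E => ->.
by rewrite rcons_wr num_eq1 (negPf s'1).
Qed.

Lemma write_word L c pre rest ot pos out : repr c -> head 0 rest < 4 ->
  exists2 i : 'I_(\max_c size (word c)).+1, i = size (word c) :> nat &
  reach ninp (conf L pre (c, rest, ot, pos, out))
    (LConf (pre ++ rest) (codes L) (num (c, i)) (size pre) (ot ++ word c) pos out).
Proof.
move=> rc lt4.
have bound k : k <= size (word c) -> k < (\max_c size (word c)).+1.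
  by move=> le_k; rewrite ltnS (leq_trans le_k) // leq_bigmax.
exists (inord (size (word c))); first by rewrite inordK ?bound.
rewrite -{2}[word c]take_size; have := leqnn (size (word c)).
elim: {1 3 4}(size _) => [|k IHk] lt_k.
  by rewrite inord0 take0 cats0; apply: reach_refl.
apply: reach_trans (IHk (ltnW lt_k)) _; apply: reach_step.
rewrite (lstep_repr _ _ _ _ _ (s' := (c, inord k.+1)) (b := nth 0 (word c) k) (d := 1)) //.
- congr (Some (LConf _ _ _ _ _ _ _)).
  rewrite (take_nth 0) // -cats1 catA /wr; case: eqP => // E.
  by have := word_neq0 c; rewrite -E mem_nth.
- by rewrite /step inordK ?bound ?(ltnW lt_k) // lt_k.
(* A state with a positive counter differs from [at0 Done], so no split occurs. *)
rewrite xpair_eqE negb_and; apply/orP; right.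
by apply/eqP => /(congr1 val); rewrite /= inordK ?bound.
Qed.

Lemma leads_right L c a rest ot pos out c' b :
  repr c -> a < 4 -> act c a = Some (c', b, 2) -> c' != Done ->
  leads L (c, a :: rest, ot, pos, out) (c', rest, ot ++ word c ++ wr b, pos, out).
Proof.
move=> rc lt4 E c'1 pre; exists (rcons pre a).
have [i Ei Hi] := write_word L pre ot pos out rc (lt4 : head 0 (a :: rest) < 4).
apply: reach_trans Hi _; apply: reach_step.
rewrite (lstep_repr _ _ _ _ _ (s' := at0 c') (b := b) (d := 2)) //; last 2 first.
- by rewrite /step Ei ltnn /= E.
- by rewrite xpair_eqE negb_and c'1.
(* The head stands on [a], so the clamp at the right end is inactive. *)
by rewrite /= size_cat size_rcons cat_rcons catA /= addnS (minn_idPl _) // ltnS leq_addr.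
Qed.

Lemma leads_stay L c rest ot pos out c' b :
  repr c -> head 0 rest < 4 -> act c (head 0 rest) = Some (c', b, 1) ->
  c' != Done ->
  leads L (c, rest, ot, pos, out) (c', rest, ot ++ word c ++ wr b, pos, out).
Proof.
move=> rc lt4 E c'1 pre; exists pre.
have [i Ei Hi] := write_word L pre ot pos out rc lt4.
apply: reach_trans Hi _; apply: reach_step.
rewrite (lstep_repr _ _ _ _ _ (s' := at0 c') (b := b) (d := 1)) //; last 2 first.
- by rewrite /step Ei ltnn E.
- by rewrite xpair_eqE negb_and c'1.
by rewrite catA.
Qed.

Lemma leads_index L b e k rest ot pos out :
  leads L (Index b e, nseq k 1 ++ [:: 2, 1, 2 & rest], ot, pos, out)
    (Count e ord0, rest, ot ++ word (Index b e) ++ nseq k 1 ++ [:: 2; 1; 2],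
     pos, out).
Proof.
elim: k b ot => [|k IHk] b ot.
  apply: leads_trans (leads_right _ _ _ _ _ (c' := Tag e) (b := 2) _ _ _ _) _ => //.
  apply: leads_trans (leads_right _ _ _ _ _ (c' := Tag e) (b := 1) _ _ _ _) _ => //.
  have := leads_right L rest (((ot ++ word (Index b e) ++ [:: 2]) ++ [:: 1])) pos out
    (c := Tag e) (a := 2) (c' := Count e ord0) (b := 2).
  by rewrite -!catA; apply.
apply: leads_trans
  (leads_right _ _ _ _ _ (c' := Index false e) (b := 1) _ _ _ _) _ => //.
by have := IHk false (ot ++ word (Index b e) ++ [:: 1]); rewrite -!catA.
Qed.

Lemma leads_count L e n k rest ot pos out : n + k <= #|{: option cell}| ->
  leads L (Count e (inord n), nseq k 1 ++ rest, ot, pos, out)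
    (Count e (inord (n + k)), rest, ot, pos, out).
Proof.
elim: k n => [|k IHk] n le_nk; first by rewrite addn0; apply: leads_refl.
have := IHk n.+1; rewrite addSnnS => /(_ le_nk); apply: leads_trans.
rewrite -{2}[ot]cats0; apply: (leads_right _ _ _ _ _ (b := 0)) => //=.
by rewrite inordK // ltnS; apply: leq_trans le_nk; rewrite leq_addr.
Qed.

Lemma leads_entry L e k v rest ot pos out :
  leads L (Index true e, encode_tr (item k v) ++ rest, ot, pos, out)
    (dispatch e v, [:: 2, 2, 3 & rest],
     ot ++ nseq k.+2 1 ++ [:: 2; 1; 2], pos, out).
Proof.
rewrite /encode_tr /= -!catA /= -catA /=; apply: leads_trans (leads_index _ _ _ _ _ _ _ _) _.
have := @leads_count L e 0 (code v) [:: 2, 2, 3 & rest]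
  (ot ++ nseq k.+2 1 ++ [:: 2; 1; 2]) pos out (ltnW (code_lt v)).
rewrite inord0 => /leads_trans; apply.
rewrite -{2}[ot ++ _]cats0; apply: (leads_stay _ _ _ _ (b := 0)) => //=.
  by rewrite inordK ?nth_code // ltnS ltnW ?code_lt.
by case: v => [[g [q|]]|].
Qed.

Lemma leads_put L h e rest ot pos out :
  leads L (Put h e, [:: 2, 2, 3 & rest], ot, pos, out)
    (Index true e, rest, ot ++ nseq (code (Some h)) 1 ++ [:: 2; 2; 3], pos, out).
Proof.
apply: leads_trans (leads_right _ _ _ _ _ (c' := Close e) (b := 2) _ _ _ _) _ => //.
apply: leads_trans (leads_right _ _ _ _ _ (c' := Close e) (b := 2) _ _ _ _) _ => //.
have := leads_right L rest ((ot ++ nseq (code (Some h)) 1 ++ [:: 2]) ++ [:: 2]) pos out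
    (c := Close e) (a := 3) (c' := Index true e) (b := 3).
by rewrite -!catA; apply.
Qed.

Lemma encode_item k v :
  encode_tr (item k v) = nseq k 1 ++ [:: 2; 1; 2] ++ nseq (code v) 1 ++ [:: 2; 2; 3].
Proof. by []. Qed.

Lemma leads_cell L h f k g rest ot pos out :
  leads L (Index true (h, f), encode_tr (item k (Some (g, None))) ++ rest, ot, pos, out)
    (Index true ((g, f), None), rest, ot ++ encode_tr (item k.+2 (Some h)), pos, out).
Proof.
apply: leads_trans (leads_entry _ _ _ _ _ _ _ _) _.
have := leads_put L h ((g, f), None) rest (ot ++ nseq k.+2 1 ++ [:: 2; 1; 2]) pos out.
by rewrite encode_item -!catA.
Qed.

Lemma leads_copy L s ot pos out : all [pred a | 0 < a < 4] s ->
  leads L (Copy, s, ot, pos, out) (Copy, [::], ot ++ s, pos, out).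
Proof.
elim: s ot => [|a s IHs] ot /= => [_|/andP[/andP[a0 a4] /IHs IH]].
  by rewrite cats0; apply: leads_refl.
have := IH (ot ++ [:: a]); rewrite -catA; apply: leads_trans.
have -> : [:: a] = word Copy ++ wr a by case: a a0 {a4}.
by apply: leads_right => //=; case: a a0 {a4}.
Qed.

(** [Copy] starts inside the end marker and takes its last two symbols along with the program. *)
Lemma leads_end L h f ot pos out :
  leads L (Index true (h, f), encode (item 0 None :: program), ot, pos, out)
    (Copy, [::], ot ++ encode (codes [:: h; (blank, f)]), pos, out).
Proof.
apply: leads_trans (leads_entry _ _ _ _ _ _ _ _) _.
apply: leads_trans (leads_right _ _ _ _ _ (c' := Copy) (b := 2) _ _ _ _) _ => //.
have /leads_copy H : all [pred a | 0 < a < 4] [:: 2, 3 & encode program].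
  by rewrite /= encode_sym.
have := H L ((ot ++ nseq 2 1 ++ [:: 2; 1; 2]) ++ word (PutEnd (h, f)) ++ [:: 2]) pos out.
have -> : encode (codes [:: h; (blank, f)]) =
  encode_tr (item 2 (Some h)) ++ encode_tr (item 1 (Some (blank, f))) ++
  encode_tr (item 0 None) ++ encode program by [].
by rewrite [word _]/= !encode_item; do !rewrite -?catA /=.
Qed.

(** * One pass over the whole work tape *)

Definition plain (g : G) : cell := (g, None).

(** The pending mark falls on the first cell to the right, or on the fresh blank if there is
    none. *)
Fixpoint spread (f : option Q) (r : seq G) : seq cell :=
  if r is z :: r' then (z, f) :: spread None r' else [:: (blank, f)].

Lemma size_spread f r : size (spread f r) = (size r).+1.
Proof. by elim: r f => //= z r IHr f; rewrite IHr. Qed.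

Lemma encode_cons t c : encode (t :: c) = encode_tr t ++ encode c.
Proof. by []. Qed.

Local Opaque encode encode_tr.

(** Each content moves one tuple to the right, so the last one read is still in the carry. *)
Lemma leads_prefix L n h s rest ot pos out :
  leads L (Index true (plain h, None), encode (items n (map plain s)) ++ rest, ot, pos, out)
    (Index true (plain (last h s), None), rest,
     ot ++ encode (items n.+2 (map plain (belast h s))), pos, out).
Proof.
elim: s h ot => [|g s IHs] h ot /=; first by rewrite cats0; apply: leads_refl.
rewrite !encode_cons -catA !size_map size_belast.
apply: leads_trans (leads_cell _ _ _ _ _ _ _ _ _) _.
by have := IHs g (ot ++ encode_tr (item (n + size s).+3 (Some (plain h)))); rewrite -catA.
Qed.

Lemma leads_suffix L h f r ot pos out :
  leads L (Index true (h, f), encode (codes (map plain r)), ot, pos, out)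
    (Copy, [::], ot ++ encode (codes (h :: spread f r)), pos, out).
Proof.
elim: r h f ot => [|g r IHr] h f ot; first exact: leads_end.
rewrite /codes /= !encode_cons !size_spread size_map.
apply: leads_trans (leads_cell _ _ _ _ _ _ _ _ _) _.
have := IHr (g, f) None (ot ++ encode_tr (item (size r).+3 (Some h))).
by rewrite -catA /codes /= size_spread.
Qed.

Definition gen L pos out := LConf (encode (codes L)) (codes L) aa_q0 0 [::] pos out.

Lemma reach_split L L' pos out pre :
  reach ninp (conf L pre (Copy, [::], encode (codes L'), pos, out)) (gen L' pos out).
Proof.
apply: reach_step; rewrite /= reproducing_num /= nth_cat ltnn subnn /=.
by rewrite aa_delta_codes //= proper_codes.
Qed.

Lemma lstep_start L pos out :
  lstep ninp (gen L pos out) = Some (conf L [::]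
    (Index true (plain blank, None), encode (codes L), [::], pos, out)).
Proof.
rewrite /gen /aa_q0 -num_start /lstep reproducing_num aa_delta_codes //=.
by rewrite /ninp; have := ltn_ord (inp pos); lia.
Qed.

Lemma step_at0 c a : word c = [::] ->
  step (at0 c) a = omap (fun r : ctl * nat * nat => (at0 r.1.1, r.1.2, r.2)) (act c a).
Proof. by rewrite /step /at0 => ->. Qed.

Lemma leads_act L h q g c' b d rest ot pos out :
  act (Act h q g) (ninp pos) = Some (c', b, d) -> c' != Done ->
  leads L (Act h q g, rest, ot, pos, out)
    (c', rest, ot, if d == 2 then pos.+1 else pos, out ++ wr b).
Proof.
move=> E c'1 pre; exists pre; apply: reach_step.
have lt_a : ninp pos < 4 + kin.
  by rewrite /ninp; have := ltn_ord (inp pos); lia.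
rewrite /= reproducing_num [repr _]/= aa_delta_codes // step_at0 // E /=.
by rewrite num_eq1 xpair_eqE (negPf c'1) rcons_wr.
Qed.

Lemma leads_marked L s x q r pos out ot :
  L = map plain s ++ (x, Some q) :: map plain r ->
  leads L (Index true (plain blank, None), encode (codes L), ot, pos, out)
    (Act (plain (last blank s)) q x, [:: 2, 2, 3 & encode (codes (map plain r))],
     ot ++ encode (items (size r).+3 (map plain (belast blank s))) ++
     nseq (size r).+3 1 ++ [:: 2; 1; 2], pos, out).
Proof.
move=> EL; rewrite [X in encode (codes X)]EL /codes items_cat /= -catA encode_cat !size_map add0n.
apply: leads_trans (leads_prefix _ _ _ _ _ _ _ _) _.
rewrite encode_cons.
apply: leads_trans (leads_entry _ _ _ _ _ _ _ _) _.
by rewrite -catA; apply: leads_refl.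
Qed.

(** The step count is stated as a successor so that lineage time will bound machine time. *)
Lemma generation L s x q r pos out h' e b d :
  L = map plain s ++ (x, Some q) :: map plain r ->
  act (Act (plain (last blank s)) q x) (ninp pos) = Some (Put h' e, b, d) ->
  exists t, lrun ninp (gen L pos out) t.+1 =
    gen (map plain (belast blank s) ++ h' :: e.1 :: spread e.2 r)
      (if d == 2 then pos.+1 else pos) (out ++ wr b).
Proof.
move=> EL /leads_act Eact; set L' := _ ++ _.
suff [t Et] : reach ninp (conf L [::]
    (Index true (plain blank, None), encode (codes L), [::], pos, out))
    (gen L' (if d == 2 then pos.+1 else pos) (out ++ wr b)).
  exists t; rewrite -Et /lrun iterSr; congr (iter _ _ _).
  by rewrite lstep_start.
apply: leads_reach (leads_marked _ _ _ EL) _ => pre1.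
apply: leads_reach (Eact _ _ _ _ isT) _ => pre2.
apply: leads_reach (leads_put _ _ _ _ _ _ _) _ => pre3.
case: e {Eact} @L' => e1 e2 L'.
apply: leads_reach (leads_suffix _ _ _ _ _ _ _) _ => pre4.
set X := (X in conf _ _ (_, _, X, _, _)).
suff -> : X = encode (codes L') by apply: reach_split.
(* The indices agree: the scanned cell had index [(size r).+1], raised by 2, and in [L'] there are
   [(size r).+2] cells to the right of [h']. *)
rewrite {}/X {}/L' /codes items_cat /= -[in RHS]catA encode_cat /=.
rewrite !(encode_cons (item _ _)) size_spread !add0n.
by rewrite 2!encode_item -[[:: 1, 1, 1 & _]]/(nseq _.+3 1 ++ [:: 2; 1; 2]) -!catA.
Qed.

(** The stored tape gains two blanks per generation while the zipper may not grow, hence the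
    arbitrary padding on both sides. *)
Definition represents (q : Q) (T : wtape G) (L : seq cell) :=
  let: (l, x, r) := T in exists a b,
  L = map plain (nseq a blank ++ rev l) ++
      (x, Some q) :: map plain (r ++ nseq b blank).

Lemma spread_nseq f b :
  spread f (nseq b blank) = (blank, f) :: map plain (nseq b blank).
Proof. by elim: b f => //= b IHb f; rewrite IHb. Qed.

Lemma spread_none r b :
  spread None (r ++ nseq b blank) = map plain (r ++ nseq b.+1 blank).
Proof.
by elim: r => [|z r IHr]; rewrite /= ?IHr ?spread_nseq.
Qed.

Lemma represents_tmove a b l r y q m :
  let s := nseq a blank ++ rev l in
  let p := rewritten (plain (last blank s)) q y m in
  represents q (tmove blank m (l, y, r))
    (map plain (belast blank s) ++ p.1 :: p.2.1 ::
       spread p.2.2 (r ++ nseq b blank)).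
Proof.
move=> s /=.
have split_s : map plain (belast blank s) ++ [:: plain (last blank s)] =
    map plain (nseq a.+1 blank ++ rev l).
  by rewrite cats1 -map_rcons -lastI.
case: m => /=.
(* With [l] empty the head moves onto the last left blank, so the left padding stays at [a]. *)
- rewrite spread_none; case: l @s split_s => [|z l] s.
    rewrite [nseq a.+1 _]/= -[blank :: _]/(nseq a.+1 blank) -addn1 nseqD.
    rewrite cats0 map_cat => /eqP; rewrite eqseq_cat ?size_map ?size_belast ?size_cat ?addn0 //.
    case/andP => /eqP -> /eqP[->]; exists a, b.+1.
    by rewrite /= cats0.
  rewrite rev_cons -rcons_cat map_rcons cats1 => /rcons_inj[-> ->].
  by exists a.+1, b.+1.
- exists a.+1, b.+1.
  by rewrite spread_none -split_s -catA.
rewrite -cat_rcons -cats1 split_s -cat_rcons -cats1.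
have -> : map plain (nseq a.+1 blank ++ rev l) ++ [:: (y, None)] =
    map plain (nseq a.+1 blank ++ rev (y :: l)).
  by rewrite rev_cons -rcons_cat map_rcons cats1.
(* With [r] empty the mark takes the first right blank, so the right padding stays at [b]. *)
case: r => [|z r] /=; last by exists a.+1, b.+1; rewrite spread_none.
by exists a.+1, b; rewrite spread_nseq.
Qed.

(** * Agreement of the lineage with the machine *)

Definition output (C : iconf Q G kout) : seq nat :=
  [seq (nat_of_ord o).+1 | o <- i_out C].

Lemma generation_step C C' L :
  istep blank delta inp C = Some C' ->
  represents (i_state C) (i_tape C) L ->
  exists2 L', represents (i_state C') (i_tape C') L' &
  exists t, lrun ninp (gen L (i_pos C) (output C)) t.+1 =
    gen L' (i_pos C') (output C').
Proof.
case: C => q [[l x] r] pos out /= E [a [b EL]].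
(* Working and reading steps are treated alike; they differ only in [d], which is 2 exactly for a
   read. *)
suff [q' [y [m [o [d [Ea ->]]]]]] : exists q' y m o d,
    act (Act (plain (last blank (nseq a blank ++ rev l))) q x) (ninp pos) =
      perform (plain (last blank (nseq a blank ++ rev l))) (q', y, m, o) d /\
    C' = IConf q' (tmove blank m (l, y, r)) (if d == 2 then pos.+1 else pos)
                 (if o is Some z then rcons out z else out).
  have := represents_tmove a b l r y q' m.
  move: Ea; rewrite /perform; case: rewritten => h' e Ea rep.
  have [t Et] := generation (map (fun o : 'I_kout => (o : nat).+1) out) EL Ea.
  eexists; first exact: rep.
  exists t; apply: etrans Et _; congr gen.
  by case: o {Ea} => [z|] /=; rewrite /output ?cats0 //= map_rcons cats1.
move: E; rewrite /act; case: (delta q x) => // [q' y m o [<-]|f].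
  by exists q', y, m, o, 1.
rewrite /ninp /=; case E: (f (inp pos)) => [[[q' y] m] o] [<-].
by exists q', y, m, o, 2; rewrite valK E.
Qed.

(** The pass reaches [Act] without touching the output stream and is stuck there, since [delta]
    halts. *)
Lemma generation_halt C L :
  istep blank delta inp C = None ->
  represents (i_state C) (i_tape C) L ->
  exists2 t, lstep ninp (lrun ninp (gen L (i_pos C) (output C)) t) = None &
  l_out (lrun ninp (gen L (i_pos C) (output C)) t) = output C.
Proof.
case: C => q [[l x] r] pos out /= E [a [b EL]].
set C := gen _ _ _; set o := output _ in C *.
have [pre [t Et]] : exists pre, reach ninp C (conf L pre
    (Act (plain (last blank (nseq a blank ++ rev l))) q x,
     [:: 2, 2, 3 & encode (codes (map plain (r ++ nseq b blank)))],
     [::] ++ encode (items (size (r ++ nseq b blank)).+3 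
       (map plain (belast blank (nseq a blank ++ rev l)))) ++
     nseq (size (r ++ nseq b blank)).+3 1 ++ [:: 2; 1; 2], pos, o)).
  have [pre R] := leads_marked pos o [::] EL [::].
  by exists pre; apply: reach_trans (reach_step (lstep_start _ _ _)) R.
exists t; rewrite Et //.
rewrite /conf /lstep reproducing_num [repr _]/= aa_delta_codes //; last first.
  by rewrite /ninp; have := ltn_ord (inp pos); lia.
rewrite step_at0 // /act; case: (delta q x) E => // f.
by case: (f _) => [[[? ?] ?] ?].
Qed.

(** The last clause serves the converse inclusion: unless the machine has halted, the lineage has
    run at least as long as the machine. *)
Lemma simulation q0 t :
  let C := irun blank delta inp (IConf q0 ([::], blank, [::]) 0 [::]) t in
  exists L T, [/\ represents (i_state C) (i_tape C) L,
    lrun ninp (lineage_start (codes [:: (blank, Some q0)])) T =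
      gen L (i_pos C) (output C)
  & t <= T \/ istep blank delta inp C = None].
Proof.
elim: t => [|t [L [T [repL ET H]]]] Cn.
  by exists [:: (blank, Some q0)], 0; split; [exists 0, 0| |left].
set C := irun _ _ _ _ _ in repL ET H *.
rewrite {}/Cn /irun iterS -/(irun blank delta inp _ t) -/C.
case E: (istep blank delta inp C) => [C'|]; last first.
  by exists L, T; split=> //; right.
have [L' repL' [t' Et']] := generation_step E repL.
exists L', (T + t'.+1); split=> //; first by rewrite lrunD ET.
by case: H; rewrite ?E // => le_tT; left; lia.
Qed.

End Simulation.

Theorem theorem2 (kin kout : nat) (Q G : finType) (blank : G) (q0 : Q)
    (delta : Q -> G -> iaction Q G kin kout) :
  exists c1 : seq trans, wf_code c1 /\
    forall inp : nat -> 'I_kin,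
      same_stream (itm_out blank q0 delta inp)
                  (lineage_out c1 (fun i => (nat_of_ord (inp i)).+1)).
Proof.
exists (codes blank delta [:: (blank, Some q0)]); split; first exact: wf_codes.
move=> inp n y; split=> -[t Et].
  have [L [T [_ ET _]]] := simulation blank delta inp q0 t.
  by exists T; rewrite /lineage_out ET.
have [L [T [repL ET H]]] := simulation blank delta inp q0 t.
exists t; rewrite /itm_out -/(output _).
case: H => [le_tT|halt].
  by have := prefix_onth (lrun_prefix _ _ le_tT) Et; rewrite ET.
(* A stuck lineage keeps its output forever, so its run may be prolonged past time [t]. *)
have [t' stuck out_t'] := generation_halt halt repL.
rewrite -out_t' -ET -lrunD; rewrite -ET -lrunD in stuck.
have le_t : t <= T + t' + t by rewrite leq_addl.
by have := prefix_onth (lrun_prefix _ _ le_t) Et; rewrite lrunD lrun_stuck.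
Qed.
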